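(* Let $\mathcal X,\mathcal Z$ be complex Hilbert spaces and let $(E,AQ)$ be a port-Hamiltonian differential-algebraic equation (pH-DAE), where $E,Q\in L(\mathcal X,\mathcal Z)$ and $A\colon\mathcal D(A)\subseteq\mathcal Z\to\mathcal Z$. Then for all classical solutions $x\colon\mathbb R_{\ge0}\to\mathcal X$ of $\frac{d}{dt}Ex(t)=AQx(t)$, $t\ge0$, $$\frac{d}{dt}\langle Ex(t),Qx(t)\rangle_{\mathcal Z}\le0,\qquad t\ge0.$$
   Context: $L(\mathcal X,\mathcal Z)$ denotes bounded linear operators. The pair $(E,AQ)$, i.e. the equation $\frac{d}{dt}Ex(t)=AQx(t)$, $t\ge0$, $Ex(0)=z_0\in\mathcal Z$, is a pH-DAE if: $E,Q\in L(\mathcal X,\mathcal Z)$; $A\colon\mathcal D(A)\subseteq\mathcal Z\to\mathcal Z$ is closed, densely defined and dissipative ($\operatorname{Re}\langle Az,z\rangle\le0$ for all $z\in\mathcal D(A)$); $\operatorname{ran}E$ is closed; $Q$ is (boundedly) invertible; and $E^*Q=Q^*E\ge0$, where an operator $T\in L(\mathcal X)$ is non-negative, $T\ge0$, if $\langle Tx,x\rangle\ge0$ for all $x\in\mathcal X$. The domain of $AQ$ is $\mathcal D(AQ)=\{x\in\mathcal X:Qx\in\mathcal D(A)\}$. The function $H(x)=\langle Ex,Qx\rangle_{\mathcal Z}$ is the Hamiltonian. Classical solution: $x\colon\mathbb R_{\ge0}\to\mathcal X$ is continuous on $\mathbb R_{\ge0}$, $Ex(\cdot)$ is continuously differentiable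 on $\mathbb R_{>0}$, $x(t)\in\mathcal D(AQ)$ for all $t\ge0$, the initial condition is satisfied, and $\frac{d}{dt}Ex(t)=AQx(t)$ holds for $t\ge0$. Derivatives at $t=0$ are one-sided. *)

(* Defs.v *)
From HB Require Import structures.
From mathcomp Require Import all_boot all_order all_algebra.
From mathcomp Require Import sesquilinear complex.
From mathcomp Require Import all_classical all_reals all_analysis.

Set Implicit Arguments.
Unset Strict Implicit.
Unset Printing Implicit Defensive.

Import Order.TTheory GRing.Theory Num.Theory.
Import numFieldNormedType.Exports.

Local Open Scope classical_set_scope.
Local Open Scope ring_scope.
Local Open Scope complex_scope.

(* Complex Hilbert spaces.  The inner product is linear in its first argument
   and conjugate-linear in the second one; norms take their values in R[i]. *)
HB.mixin Record NormedModule_isHilbert (R : realType) X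
    & CompleteNormedModule R[i] X := {
  inner_subdef : {dot X for (@Num.conj R[i])} ;
  sqr_normE_subdef : forall x : X, `|x| ^+ 2 = inner_subdef x x }.

#[short(type="hilbertType")]
HB.structure Definition Hilbert (R : realType) :=
  { X of CompleteNormedModule R[i] X & NormedModule_isHilbert R X }.

Definition inner (R : realType) (X : hilbertType R) :
  {dot X for (@Num.conj R[i])} := @inner_subdef R X.

Notation "''[' x , y ]" := (@inner _ _ x y)
  (format "''[' x ,  y ]") : ring_scope.

Definition bounded_operator (K : numFieldType) (X Z : normedModType K)
    (T : {linear X -> Z}) : Prop :=
  exists M : K, forall x, `|T x| <= M * `|x|.

Definition boundedly_invertible (K : numFieldType) (X Z : normedModType K)
    (T : {linear X -> Z}) : Prop :=
  exists S : {linear Z -> X}, [/\ bounded_operator S, cancel T S & cancel S T].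

(* [adjoint T z] is the vector representing x |-> <T x, z>.  For a bounded T it
   exists and is unique by Riesz's theorem; the default value 0 is then unused. *)
Definition adjoint (R : realType) (X Z : hilbertType R) (T : {linear X -> Z})
    (z : Z) : X :=
  xget 0 [set y : X | forall x, '[T x, z] = '[x, y]].

(* In the order of R[i], 0 <= c means that c is real and nonnegative. *)
Definition nonneg_operator (R : realType) (X : hilbertType R) (T : X -> X) :
  Prop := forall x, 0 <= '[T x, x].

(* Linear operators defined on a linear subspace; the values of [opfun] outside
   [opdom] are irrelevant. *)
Record operator (K : numFieldType) (X Z : normedModType K) := Operator {
  opdom : set X ;
  opfun :> X -> Z ;
  opdom0 : opdom 0 ;
  opdom_linear : forall (a : K) u v,
    opdom u -> opdom v -> opdom (a *: u + v) ;
  opfun_linear : forall (a : K) u v, opdom u -> opdom v ->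
    opfun (a *: u + v) = a *: opfun u + opfun v }.

Section operator_properties.
Variables (K : numFieldType) (X Z : normedModType K) (A : operator X Z).

Definition operator_graph : set (X * Z) :=
  [set p | opdom A p.1 /\ p.2 = A p.1].

Definition closed_operator : Prop := closed operator_graph.

Definition densely_defined : Prop := dense (opdom A).

End operator_properties.

Definition dissipative (R : realType) (Z : hilbertType R) (A : operator Z Z) :
  Prop := forall z, opdom A z -> complex.Re '[A z, z] <= 0.

Section operator_comp.
Variables (K : numFieldType) (X Y Z : normedModType K).
Variables (A : operator Y Z) (Q : {linear X -> Y}).

Let dom : set X := [set x | opdom A (Q x)].

Let dom0 : dom 0.
Proof. by rewrite /dom /= linear0; exact: opdom0. Qed.

Let dom_linear (a : K) u v : dom u -> dom v -> dom (a *: u + v).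
Proof. by rewrite /dom /= linearP; exact: opdom_linear. Qed.

Let fun_linear (a : K) u v : dom u -> dom v ->
  A (Q (a *: u + v)) = a *: A (Q u) + A (Q v).
Proof. by rewrite /dom /= linearP; exact: opfun_linear. Qed.

Definition operator_comp : operator X Z :=
  @Operator K X Z dom (fun x => A (Q x)) dom0 dom_linear fun_linear.

End operator_comp.

Record pH_DAE (R : realType) (X Z : hilbertType R)
    (E : {linear X -> Z}) (A : operator Z Z) (Q : {linear X -> Z}) : Prop := {
  pH_E_bounded : bounded_operator E ;
  pH_Q_bounded : bounded_operator Q ;
  pH_A_closed : closed_operator A ;
  pH_A_dense : densely_defined A ;
  pH_A_dissipative : dissipative A ;
  pH_E_closed_range : closed (range E) ;
  pH_Q_invertible : boundedly_invertible Q ;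
  pH_EQ_sym : adjoint E \o Q = adjoint Q \o E ;
  pH_EQ_nonneg : nonneg_operator (adjoint E \o Q) }.

(* Derivative along the real line of a function with values in a complex space:
   the difference quotient tends to [l] as s -> t with s in [I] and s != t.  It
   is the one-sided derivative when t is an endpoint of the interval [I]. *)
Definition has_deriv_within (R : realType) (V : normedModType R[i])
    (I : set R) (f : R -> V) (t : R) (l : V) : Prop :=
  ((s - t)^-1)%:C *: (f s - f t) @[s --> within I t^'] --> l.

(* Only the values of [x] on `[0, +oo[ matter. *)
Record classical_solution (R : realType) (X Z : hilbertType R)
    (E : {linear X -> Z}) (B : operator X Z) (z0 : Z) (x : R -> X) : Prop := {
  sol_continuous : {within `[0, +oo[, continuous x} ;
  sol_C1 : exists g : R -> Z,
    (forall t, 0 < t -> has_deriv_within `]0, +oo[ (E \o x) t (g t)) /\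
    {within `]0, +oo[, continuous g} ;
  sol_dom : forall t, 0 <= t -> opdom B (x t) ;
  sol_init : E (x 0) = z0 ;
  sol_eq : forall t, 0 <= t ->
    has_deriv_within `[0, +oo[ (E \o x) t (B (x t)) }.

Definition hamiltonian (R : realType) (X Z : hilbertType R)
    (E Q : {linear X -> Z}) (x : X) : R[i] := '[E x, Q x].

(* Main.v *)
(* Writing E^*Q = Q^*E as <Eu,Qv> = <Qu,Ev> (which needs E^* and Q^* to exist,
   hence Riesz's theorem) gives
     <Ex(s),Qx(s)> - <Ex(t),Qx(t)> = <Ex(s)-Ex(t),Qx(s)> + <Qx(t),Ex(s)-Ex(t)>,
   in which only Ex is differentiated; so x need only be continuous, and the
   derivative at t is <AQx,Qx> + <Qx,AQx> = 2 Re <AQx,Qx> <= 0. *)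

Require Import Defs.
From HB Require Import structures.
From mathcomp Require Import all_boot all_order all_algebra.
From mathcomp Require Import sesquilinear complex.
From mathcomp Require Import all_classical all_reals all_analysis.
From mathcomp Require Import ring lra.

Set Implicit Arguments.
Unset Strict Implicit.
Unset Printing Implicit Defensive.

Import Order.TTheory GRing.Theory Num.Theory.
Import numFieldNormedType.Exports.

Local Open Scope classical_set_scope.
Local Open Scope ring_scope.

(** * Limits from norm estimates *)

(** On a trivial space even a negative [M] is a bound. In every case [M * |x|] dominates a norm, so
    it is nonnegative and equals its own norm. *)
Lemma bound_norm (K : numFieldType) (V W : normedZmodType K) (f : V -> W) :
  (exists M : K, forall x, `|f x| <= M * `|x|) ->
  exists M : K, forall x, `|f x| <= `|M| * `|x|.
Proof.
move=> [M fM]; exists M => x.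
rewrite -[X in _ * X]normr_id -normrM (le_trans (fM x))// real_ler_norm//.
by rewrite ger0_real// (le_trans _ (fM x)).
Qed.

Lemma cvg_norm_le (K : numFieldType) (V : normedModType K) (T : Type)
    (F : set_system T) (FF : Filter F) (f : T -> V) (l : V) (g : T -> K) :
  (forall s, `|f s - l| <= g s) -> g s @[s --> F] --> 0 -> f s @[s --> F] --> l.
Proof.
move=> fg /cvgr0Pnorm_lt g0; apply/cvgrPdistC_lt => e e0.
apply: filterS (g0 e e0) => s; apply: le_lt_trans.
by rewrite ger0_norm ?fg// (le_trans _ (fg s)).
Qed.

(* The hypothesis is the estimate satisfied by [f s = B (u s) (v s)] and
   [l = B a b] when the sesquilinear map [B] has norm at most 1. *)
Lemma cvg_bilinear_le (K : numFieldType) (U V W : normedModType K) (T : Type)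
    (F : set_system T) (FF : Filter F) (u : T -> U) (v : T -> V) (f : T -> W)
    (a : U) (b : V) (l : W) :
  (forall s, `|f s - l| <= `|u s - a| * `|v s| + `|a| * `|v s - b|) ->
  u s @[s --> F] --> a -> v s @[s --> F] --> b -> f s @[s --> F] --> l.
Proof.
move=> fl ua vb; apply: cvg_norm_le fl _.
have ua0 : `|u s - a| @[s --> F] --> (0 : K).
  by apply/norm_cvg0P; apply/subr_cvg0.
have vb0 : `|v s - b| @[s --> F] --> (0 : K).
  by apply/norm_cvg0P; apply/subr_cvg0.
rewrite [X in _ --> X](_ : _ = 0 * `|b| + `|a| * 0); last first.
  by rewrite mul0r mulr0 addr0.
by apply: cvgD; apply: cvgM => //; [exact: cvg_norm|exact: cvg_cst].
Qed.

(** * Continuity of the inner product and of bounded operators *)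

Section inner_product.
Variables (R : realType) (X : hilbertType R).
Implicit Types (x y : X) (a : R[i]).

Lemma sqr_normE x : `|x| ^+ 2 = '[x, x].
Proof. exact: sqr_normE_subdef. Qed.

Lemma inner_conj x y : '[x, y] = Num.conj '[y, x].
Proof. by rewrite (hermC (@inner R X)) expr0 mul1r. Qed.

Lemma innerZl a x y : '[a *: x, y] = a * '[x, y].
Proof. exact: linearZl_LR. Qed.

Lemma innerZr a x y : '[x, a *: y] = Num.conj a * '[x, y].
Proof. exact: linearZr_LR. Qed.

(** Expand the squared norm of [<y, y> x - <x, y> y], then divide by [<y, y> > 0]. *)
Lemma inner_CauchySchwarz x y : `|'[x, y]| <= `|x| * `|y|.
Proof.
have [->|y0] := eqVneq y 0; first by rewrite linear0r !normr0 mulr0.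
have y_gt0 : 0 < `|y| ^+ 2 by rewrite exprn_gt0// normr_gt0.
have y_real : Num.conj '[y, y] = '[y, y] by rewrite -inner_conj.
have : 0 <= `|'[y, y] *: x - '[x, y] *: y| ^+ 2 by rewrite exprn_ge0.
rewrite sqr_normE linearBl !linearBr /= !innerZl !innerZr y_real.
rewrite (inner_conj y x).
have -> : '[y, y] * ('[y, y] * '[x, x]) -
   '[y, y] * (Num.conj '[x, y] * '[x, y]) -
  ('[x, y] * ('[y, y] * Num.conj '[x, y]) -
   '[x, y] * (Num.conj '[x, y] * '[y, y])) =
  '[y, y] * ('[x, x] * '[y, y] - '[x, y] * Num.conj '[x, y]) by ring.
rewrite -normCK -!sqr_normE pmulr_rge0// subr_ge0 -exprMn.
by rewrite ler_sqr// nnegrE ?mulr_ge0.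
Qed.

Lemma cvg_inner (T : Type) (F : set_system T) (FF : Filter F)
    (u v : T -> X) (a b : X) :
  u s @[s --> F] --> a -> v s @[s --> F] --> b ->
  ('[u s, v s] : R[i]^o) @[s --> F] --> ('[a, b] : R[i]^o).
Proof.
apply: cvg_bilinear_le => s.
have -> : '[u s, v s] - '[a, b] = '[u s - a, v s] + '[a, v s - b].
  by rewrite linearBl linearBr /=; ring.
by rewrite (le_trans (ler_normD _ _))// lerD// inner_CauchySchwarz.
Qed.

End inner_product.

Lemma cvg_bounded_operator (K : numFieldType) (X Z : normedModType K)
    (T : {linear X -> Z}) (S : Type) (F : set_system S) (FF : Filter F)
    (u : S -> X) (a : X) :
  bounded_operator T -> u s @[s --> F] --> a -> T (u s) @[s --> F] --> T a.
Proof.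
move=> /bound_norm[M TM] ua.
apply: (@cvg_norm_le _ _ _ _ _ _ _ (fun s => `|M| * `|u s - a|)) => [s|].
  by rewrite -linearB.
rewrite -[X in _ --> X](mulr0 `|M|).
apply: cvgM; first exact: cvg_cst.
by apply/norm_cvg0P; apply/subr_cvg0.
Qed.

Local Open Scope complex_scope.

(** * Real parts of complex numbers *)

Section complex_real_part.
Variable R : rcfType.
Implicit Types (x y : R[i]) (r : R).

Lemma complexReD x y : complex.Re (x + y) = complex.Re x + complex.Re y.
Proof. by case: x; case: y. Qed.

Lemma complexReN x : complex.Re (- x) = - complex.Re x.
Proof. by case: x. Qed.

Lemma complexReMl r x : complex.Re (r%:C * x) = r * complex.Re x.
Proof. by case: x => a b /=; rewrite mul0r subr0. Qed.

Lemma complexReJ x : complex.Re (Num.conj x) = complex.Re x.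
Proof. by case: x. Qed.

(** Norms take values in [R[i]]; this transfers their inequalities to [R], where [lra] and [nra]
    apply. *)
Lemma norm_complexRe x : (complex.Re `|x|)%:C = `|x|.
Proof. by rewrite RRe_real// normr_real. Qed.

Lemma normr_le_complexRe_norm x : `|complex.Re x| <= complex.Re `|x|.
Proof. by rewrite -lecR norm_complexRe normc_ge_Re. Qed.

End complex_real_part.

(** * Riesz representation theorem *)

(* The representing vector minimizes [J x = Re (<x, x> - 2 f x)]. *)
Section riesz.
Variables (R : realType) (X : hilbertType R) (f : X -> R[i]).
Hypothesis f_scalar : scalar f.
Hypothesis f_bounded : exists M : R[i], forall x, `|f x| <= M * `|x|.

Let fD x y : f (x + y) = f x + f y.
Proof. by rewrite -[x in LHS]scale1r f_scalar mul1r. Qed.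

Let f0 : f 0 = 0.
Proof. by apply: (addIr (f 0)); rewrite -fD !add0r. Qed.

Let fZ a x : f (a *: x) = a * f x.
Proof. by rewrite -[a *: x]addr0 f_scalar f0 addr0. Qed.

Let J (x : X) : R := complex.Re '[x, x] - 2 * complex.Re (f x).

Let sqn (x : X) : R := complex.Re '[x, x].

(* Half the derivative of [J] at [x] along [w]. *)
Let gap (x w : X) : R := complex.Re ('[w, x] - f w).

Let J_expand (x w : X) (s : R) :
  J (x + s%:C *: w) = J x + s ^+ 2 * sqn w + 2 * s * gap x w.
Proof.
rewrite /J /sqn /gap fD fZ linearDl !linearDr /= !innerZl !innerZr.
rewrite (inner_conj x w) complexReD !complexReD complexReN !complexReMl.
have -> : Num.conj s%:C = s%:C by exact: conjc_real.
rewrite !complexReMl complexReJ; ring.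
Qed.

Let sqnE x : (sqn x)%:C = `|x| ^+ 2.
Proof. by rewrite /sqn -sqr_normE RRe_real// ger0_real// exprn_ge0. Qed.

Let sqn_ge0 x : 0 <= sqn x.
Proof. by rewrite -lecR sqnE exprn_ge0. Qed.

Let J_lbound : has_inf (range J).
Proof.
split; first by exists (J 0); exists 0.
have [M fM] := bound_norm f_bounded.
(* Completing the square: [J x >= |x|^2 - 2 m |x| >= - m^2], with [m] the real part of [|M|]. *)
exists (- (complex.Re `|M|) ^+ 2) => _ [x _ <-].
rewrite /J -sqr_normE.
have := fM x.
rewrite -(norm_complexRe (f x)) -(norm_complexRe M).
have xE : `|x| = (complex.Re `|x|)%:C by rewrite RRe_real// normr_real.
rewrite xE -rmorphM -rmorphXn lecR /=.
have := le_trans (ler_norm _) (normr_le_complexRe_norm (f x)).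
have := sqr_ge0 (complex.Re `|M| - complex.Re `|x|).
rewrite /=; nra.
Qed.

Let Jinf := inf (range J).

Let Jinf_le x : Jinf <= J x.
Proof. by apply: ge_inf; [case: J_lbound|exists x]. Qed.

(* The parallelogram identity: [J] is evaluated at the midpoint of [x] and [y]. *)
Let sqn_dist x y : sqn (y - x) <= 2 * ((J x - Jinf) + (J y - Jinf)).
Proof.
have e1 := J_expand x (y - x) 1; have e2 := J_expand x (y - x) 2^-1.
have := Jinf_le (x + (2^-1)%:C *: (y - x)).
rewrite e2; rewrite rmorph1 scale1r addrC subrK in e1.
rewrite /=; nra.
Qed.

(** No step along [w] lowers [J] by more than [J x - Jinf], so the slope is small at a
    near-minimizer. *)
Let sqr_gap x w : gap x w ^+ 2 <= (J x - Jinf) * (sqn w + 1).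
Proof.
have n0 := sqn_ge0 w.
(* The optimal step is [- gap x w / sqn w]; the added 1 keeps the denominator positive when
   [w = 0]. *)
have := Jinf_le (x + (- gap x w / (sqn w + 1))%:C *: w).
rewrite J_expand; set d := gap x w; set n := sqn w in n0 *.
have n1 : 0 < n + 1 by lra.
move=> h.
have : 0 <= J x - Jinf + (- d / (n + 1)) ^+ 2 * (n + 1)
   + 2 * (- d / (n + 1)) * d.
  have := sqr_ge0 (- d / (n + 1)); nra.
have -> : J x - Jinf + (- d / (n + 1)) ^+ 2 * (n + 1)
   + 2 * (- d / (n + 1)) * d = J x - Jinf - d ^+ 2 / (n + 1).
  by field; lra.
by rewrite subr_ge0 ler_pdivrMr.
Qed.

(** A minimizing sequence is Cauchy by [sqn_dist], and [sqr_gap] makes the slope of [J] at its limit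
    vanish in every direction. *)
Lemma riesz_representation : exists y : X, forall x, f x = '[x, y].
Proof.
have /choice[u uJ] (n : nat) : exists x : X, J x - Jinf < n.+1%:R^-1.
  have n0 : (0 : R) < n.+1%:R^-1 by rewrite invr_gt0.
  have [_ [x _ <-] xJ] := inf_adherent n0 J_lbound.
  by exists x; rewrite ltrBlDl.
have uc : cauchy (u @ \oo).
  apply: cauchy_exP => e e0.
  have er : e = (complex.Re e)%:C by rewrite RRe_real// gtr0_real.
  have r0 : 0 < complex.Re e by rewrite -ltcR -er.
  (* With both excesses of [J] below [e^2 / 4], [sqn_dist] bounds the squared distance by [e^2]. *)
  have d0 : 0 < complex.Re e ^+ 2 / 4 by rewrite divr_gt0// exprn_gt0.
  have [N _ hN] := near_infty_natSinv_lt (PosNum d0).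
  exists (u N); exists N => //= n Nn.
  rewrite -ball_normE /= distrC.
  rewrite -(ltr_pXn2r (ltn0Sn 1)) ?nnegrE ?normr_ge0 ?(ltW e0)//.
  rewrite er -rmorphXn /=.
  rewrite -sqnE ltcR (le_lt_trans (sqn_dist _ _))//.
  have uJN k : (N <= k)%N -> J (u k) - Jinf < complex.Re e ^+ 2 / 4.
    by move=> Nk; rewrite (lt_trans (uJ k))//; exact: hN.
  have := uJN _ Nn; have := uJN _ (leqnn N).
  lra.
have /cvg_ex[/= y uy] : cvg (u @ \oo) by exact: cauchy_cvg.
exists y.
have gap0 w : complex.Re ('[w, y] - f w) = 0.
  apply/eqP/negPn/negP => g0.
  (* For large [n], both [gap (u n) w] and its distance to [gap y w] would be smaller than half of
     [|gap y w|], against the triangle inequality. *)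
  have e0 : 0 < `|gap y w| / 2 by rewrite divr_gt0// normr_gt0.
  have n1 : 0 < sqn w + 1 by rewrite ltr_wpDl.
  have wu : ('[w, u n] : R[i]^o) @[n --> \oo] --> ('[w, y] : R[i]^o).
    by apply: cvg_inner => //; exact: cvg_cst.
  have d0 : 0 < (`|gap y w| / 2) ^+ 2 / (sqn w + 1).
    by rewrite divr_gt0// exprn_gt0.
  have ec : 0 < (`|gap y w| / 2)%:C by rewrite ltcR.
  have [N1 _ h1] := @cvgr_dist_lt _ (R[i]^o) _ _ _ _ _ wu _ ec.
  have [N2 _ h2] := near_infty_natSinv_lt (PosNum d0).
  pose n := maxn N1 N2.
  have := h1 n (leq_maxl _ _) => /=.
  have := h2 n (leq_maxr _ _) => /=.
  rewrite ltr_pdivlMr// => k2.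
  have k3 : gap (u n) w ^+ 2 < (`|gap y w| / 2) ^+ 2.
    apply: le_lt_trans (sqr_gap _ _) _; apply: lt_trans k2.
    by rewrite ltr_pM2r.
  rewrite -norm_complexRe ltcR => k1.
  have := normr_le_complexRe_norm ('[w, y] - '[w, u n]).
  have -> : complex.Re ('[w, y] - '[w, u n]) = gap y w - gap (u n) w.
    by rewrite /gap !complexReD !complexReN; ring.
  move=> k4.
  have : `|gap (u n) w| < `|gap y w| / 2.
    rewrite -(ltr_pXn2r (ltn0Sn 1)) ?nnegrE ?normr_ge0 ?(ltW e0)//.
    by rewrite real_normK// num_real.
  have := lerB_dist (gap y w) (gap (u n) w).
  lra.
move=> x; apply/esym/eqP; rewrite -subr_eq0 eq_complex /=.
apply/andP; split; first by rewrite gap0.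
(* The real part of [i c] is minus the imaginary part of [c]. *)
have := gap0 ('i *: x); rewrite innerZl fZ -mulrBr.
by case: (_ - _) => a b /=; rewrite mul0r mul1r sub0r => /eqP; rewrite oppr_eq0.
Qed.

End riesz.

(** * Adjoints of bounded operators *)

(** Cauchy-Schwarz bounds [x |-> <T x, z>] by [|M| |z| |x|], so Riesz provides a representing vector
    and [xget] does not return its default. *)
Lemma inner_adjoint (R : realType) (X Z : hilbertType R) (T : {linear X -> Z}) :
  bounded_operator T -> forall x z, '[T x, z] = '[x, adjoint T z].
Proof.
move=> /bound_norm[M TM] x z; rewrite /adjoint.
suff /(xgetPex 0) : exists y : X, forall x, '[T x, z] = '[x, y] by apply.
apply: (riesz_representation (f := fun x => '[T x, z])) => [a u v|].
  by rewrite linearP linearDl /= innerZl.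
exists (`|M| * `|z|) => u.
by rewrite (le_trans (inner_CauchySchwarz _ _))// mulrAC ler_wpM2r//; exact: TM.
Qed.

Lemma inner_adjoint_comm (R : realType) (X Z : hilbertType R)
    (E Q : {linear X -> Z}) :
  bounded_operator E -> bounded_operator Q ->
  adjoint E \o Q = adjoint Q \o E ->
  forall x y, '[E x, Q y] = '[Q x, E y].
Proof.
move=> Eb Qb EQ x y; rewrite !inner_adjoint//.
by have /= -> := congr1 (@^~ y) EQ.
Qed.

(** * Derivative of the Hamiltonian *)

Lemma has_deriv_hamiltonian (R : realType) (X Z : hilbertType R)
    (E Q : {linear X -> Z}) (I : set R) (x : R -> X) (t : R) (z : Z) :
  bounded_operator Q -> (forall u v, '[E u, Q v] = '[Q u, E v]) ->
  x s @[s --> within I t^'] --> x t ->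
  has_deriv_within I (E \o x) t z ->
  has_deriv_within I (fun s => hamiltonian E Q (x s) : R[i]^o) t
    ('[z, Q (x t)] + '[Q (x t), z]).
Proof.
move=> Qb EQ xt dE; rewrite /has_deriv_within /hamiltonian.
have Qx : Q (x s) @[s --> within I t^'] --> Q (x t).
  exact: cvg_bounded_operator.
pose D s := ((s - t)^-1)%:C *: ((E \o x) s - (E \o x) t).
have -> : (fun s => ((s - t)^-1)%:C *:
    (('[E (x s), Q (x s)] : R[i]^o) - '[E (x t), Q (x t)])) =
  (fun s => ('[D s, Q (x s)] : R[i]^o) + '[Q (x t), D s]).
  apply/funext => s; rewrite /D /= innerZl innerZr.
  have -> : Num.conj ((s - t)^-1)%:C = ((s - t)^-1)%:C by exact: conjc_real.
  (* Symmetry turns [<Q x(t), E x(s)>] into [<E x(t), Q x(s)>], which cancels the cross term of the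
     first product. *)
  rewrite linearBl !linearBr /= -(EQ (x t) (x t)) -(EQ (x t) (x s)).
  rewrite /GRing.scale /=; ring.
apply: cvgD; first exact: cvg_inner.
by apply: cvg_inner => //; exact: cvg_cst.
Qed.

Theorem theorem4p4 (R : realType) (X Z : hilbertType R)
    (E : {linear X -> Z}) (A : operator Z Z) (Q : {linear X -> Z})
    (pH : pH_DAE E A Q) (z0 : Z) (x : R -> X)
    (solx : classical_solution E (operator_comp A Q) z0 x)
    (t : R) (t_ge0 : 0 <= t) :
  exists2 l : R[i]^o,
    has_deriv_within `[0, +oo[ (fun s => hamiltonian E Q (x s) : R[i]^o) t l &
    (l : R[i]) <= 0.
Proof.
case: pH => Eb Qb _ _ Adiss _ _ EQ _.
case: solx => xc _ xdom _ xeq.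
exists ('[A (Q (x t)), Q (x t)] + '[Q (x t), A (Q (x t))]).
  apply: has_deriv_hamiltonian (xeq t t_ge0) => //.
    exact: inner_adjoint_comm.
  (* Continuity gives the limit over all [s] near [t] in the half-line; it then restricts to
     [s != t]. *)
  have xct : x s @[s --> within `[0, +oo[ (nbhs t)] --> x t.
    by move/subspace_continuousP : xc; apply; rewrite /= in_itv /= andbT.
  move=> U /xct; exact: nbhs_dnbhs.
(* A number plus its conjugate is twice its real part, whose sign comes from dissipativity at
   [Q (x t)]. *)
rewrite (inner_conj (Q (x t))).
have /= -> := addcJ '[A (Q (x t)), Q (x t)].
rewrite mulr_ge0_le0// lecR; apply: Adiss; exact: xdom.
Qed.
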